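(* Let $A\in\mathbb{R}^{n_x\times n_x}$ be invertible, $B\in\mathbb{R}^{n_x\times n_u}$, with $(A,B)$ controllable, and let $H=\begin{bmatrix}Q&S^\top\\ S&R\end{bmatrix}$ be real symmetric. Assume the stage cost is strictly pre-dissipative: there is a symmetric $\Lambda$ with $H_\Lambda\succeq0$ and $Q_\Lambda-S_\Lambda^\top R_\Lambda^\dagger S_\Lambda\succ0$. Let $\bar P_{\mathrm s}$ be the stabilizing solution of the RCGDARE, and select a symmetric terminal cost matrix $P^{\mathrm f}\succ\bar P_{\mathrm s}$. Then, for every sufficiently large finite horizon $N$, the receding-horizon optimal control problem $$\min_{x,u}\ \sum_{k=0}^{N-1}\begin{bmatrix}x_k\\ u_k\end{bmatrix}^\top H\begin{bmatrix}x_k\\ u_k\end{bmatrix}+x_N^\top P^{\mathrm f}x_N\quad\text{s.t. } x_0=\hat x_0,\ x_{k+1}=Ax_k+Bu_k$$ yields a closed-loop system $x_+=(A-BK_N)x+BG_Nv$, $v$ arbitrary, for which the origin is globally exponentially stable.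
   Context: For symmetric $M\in\mathbb{R}^{n_x\times n_x}$ define $Q_M:=Q+A^\top MA-M$, $S_M:=S+B^\top MA$, $R_M:=R+B^\top MB$, $H_M:=\begin{bmatrix}Q_M&S_M^\top\\ S_M&R_M\end{bmatrix}$. $\dagger$ denotes the Moore-Penrose pseudo-inverse. The horizon-$N$ problem delivers the feedback law $u=-K_Nx+G_Nv$, $v$ arbitrary, applied at each time step, where $P_0=P^{\mathrm f}$ and the generalized Riccati recursion is $P_{N+1}=Q+A^\top P_NA-(S^\top+A^\top P_NB)K_{N+1}$, $K_{N+1}=(R+B^\top P_NB)^\dagger(S+B^\top P_NA)$, and $G_N:=I-R_{P_{N-1}}^\dagger R_{P_{N-1}}$. Global exponential stability of the closed loop means there are $c>0$ and $\rho\in(0,1)$ such that $\|x_k\|\le c\rho^k\|x_0\|$ for all $k\ge0$, all $x_0$ and every sequence $(v_k)$. RCGDARE (symmetric unknown $\bar P$): $\bar P=\bar Q+\bar A^\top\bar P\bar A-(\bar S^\top+\bar A^\top\bar P\bar B)\bar K$, $\bar K=(\bar R+\bar B^\top\bar P\bar B)^\dagger(\bar S+\bar B^\top\bar P\bar A)$, $\ker(\bar R+\bar B^\top\bar P\bar B)\subseteq\ker(\bar S^\top+\bar A^\top\bar P\bar B)$, where $\bar A:=A^{-1}$, $\bar B:=A^{-1}B$, $\bar Q:=-\bar A^\top Q\bar A$, $\bar S:=S\bar A-\bar B^\top Q\bar A$, $\bar R:=-R+S\bar B+\bar B^\top S^\top-\bar B^\top Q\bar B$. Its stabilizing solution $\bar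 P_{\mathrm s}$ is the symmetric solution for which all eigenvalues of $\bar A-\bar B\bar K$ lie strictly inside the unit circle. *)

(* Defs.v *)
From mathcomp Require Import all_boot all_order all_algebra.
From mathcomp Require Import all_classical all_reals.
From mathcomp Require Import complex.

Set Implicit Arguments.
Unset Strict Implicit.
Unset Printing Implicit Defensive.

Import Order.TTheory GRing.Theory Num.Theory.
Local Open Scope ring_scope.

Section Matrices.
Variable F : realType.

Definition qform n (M : 'M[F]_n) (x : 'cV[F]_n) : F := (x^T *m M *m x) 0 0.

Definition psdmx n (M : 'M[F]_n) : Prop :=
  M^T = M /\ forall x : 'cV[F]_n, 0 <= qform M x.

Definition pdmx n (M : 'M[F]_n) : Prop :=
  M^T = M /\ forall x : 'cV[F]_n, x != 0 -> 0 < qform M x.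

(* The norm that MathComp-Analysis puts on matrices is the sup norm. *)
Definition enorm n (x : 'cV[F]_n) : F := Num.sqrt (\sum_i x i 0 ^+ 2).

(* [eigenvalue] over F only sees real eigenvalues, hence the passage to F[i]. *)
Definition schur_stable n (M : 'M[F]_n) : Prop :=
  forall z : F[i], eigenvalue (map_mx (real_complex F) M) z -> `|z| < 1.

Definition ker_sub m p n (M : 'M[F]_(m, n)) (L : 'M[F]_(p, n)) : Prop :=
  forall v : 'cV[F]_n, M *m v = 0 -> L *m v = 0.

Definition penrose m n (M : 'M[F]_(m, n)) (X : 'M[F]_(n, m)) : Prop :=
  [/\ M *m X *m M = M, X *m M *m X = X,
      (M *m X)^T = M *m X & (X *m M)^T = X *m M].

(* Moore-Penrose pseudo-inverse: the unique X with [penrose M X], see [pinvP]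
   and [penrose_uniq]; the default value 0 of [xget] is never taken. *)
Definition pinv m n (M : 'M[F]_(m, n)) : 'M[F]_(n, m) :=
  xget 0 (fun X => penrose M X).

Lemma gram_eq0 m n (M : 'M[F]_(m, n)) : M *m M^T = 0 -> M = 0.
Proof.
move=> h; apply/matrixP => i j; rewrite mxE.
have : \sum_k M i k ^+ 2 = 0.
  transitivity ((M *m M^T) i i); last by rewrite h mxE.
  by rewrite mxE; apply: eq_bigr => k _; rewrite mxE expr2.
move=> /eqP; rewrite psumr_eq0 => [/allP/(_ j)|k _]; last exact: sqr_ge0.
by rewrite mem_index_enum sqrf_eq0 => /(_ isT)/eqP.
Qed.

Lemma gram_unit m n (M : 'M[F]_(m, n)) : row_free M -> M *m M^T \in unitmx.
Proof.
move=> fM; rewrite -row_free_unit -kermx_eq0; apply/eqP.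
set K := kermx _.
have K0 : K *m (M *m M^T) = 0 by exact: mulmx_ker.
suff KM0 : K *m M = 0 by apply: (row_free_inj fM); rewrite KM0 mul0mx.
by apply: gram_eq0; rewrite trmx_mul -(mulmxA K) (mulmxA M) mulmxA K0 mul0mx.
Qed.

Lemma penrose_full_rank m r n (C : 'M[F]_(m, r)) (D : 'M[F]_(r, n)) :
  row_free C^T -> row_free D ->
  penrose (C *m D)
    (D^T *m invmx (D *m D^T) *m (invmx (C^T *m C) *m C^T)).
Proof.
move=> fC fD.
have uD : D *m D^T \in unitmx by exact: gram_unit.
have uC : C^T *m C \in unitmx.
  by have := gram_unit fC; rewrite trmxK.
set E := invmx (D *m D^T); set G := invmx (C^T *m C).
have DE : D *m (D^T *m E) = 1%:M by rewrite mulmxA mulmxV.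
have GC : G *m C^T *m C = 1%:M by rewrite -mulmxA mulVmx.
have sE : E^T = E by rewrite /E trmx_inv trmx_mul trmxK.
have sG : G^T = G by rewrite /G trmx_inv trmx_mul trmxK.
have MX : C *m D *m (D^T *m E *m (G *m C^T)) = C *m (G *m C^T).
  by rewrite -(mulmxA C) (mulmxA D) DE mul1mx.
have XM : D^T *m E *m (G *m C^T) *m (C *m D) = D^T *m E *m D.
  by rewrite -(mulmxA (D^T *m E)) (mulmxA (G *m C^T)) GC mul1mx.
split.
- by rewrite MX -(mulmxA C) (mulmxA (G *m C^T)) GC mul1mx.
- by rewrite XM -(mulmxA _ D) (mulmxA D) (mulmxA D) -(mulmxA D) DE mul1mx.
- by rewrite MX !trmx_mul trmxK sG mulmxA.
- by rewrite XM !trmx_mul trmxK sE mulmxA.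
Qed.

Lemma penrose_exists m n (M : 'M[F]_(m, n)) : exists X, penrose M X.
Proof.
have fC : row_free (col_base M)^T.
  by rewrite /row_free mxrank_tr; exact: col_base_full.
have := penrose_full_rank fC (row_base_free M).
by rewrite mulmx_base => h; eexists; exact: h.
Qed.

Lemma pinvP m n (M : 'M[F]_(m, n)) : penrose M (pinv M).
Proof.
by have [X hX] := penrose_exists M; exact: (xgetPex 0 (ex_intro _ X hX)).
Qed.

Lemma penrose_uniq m n (M : 'M[F]_(m, n)) X Y :
  penrose M X -> penrose M Y -> X = Y.
Proof.
move=> [x1 x2 x3 x4] [y1 y2 y3 y4].
have MXY : M *m X = M *m Y.
  by rewrite -x3 -{1}y1 -(mulmxA _ M) trmx_mul x3 y3 mulmxA x1.
have XMY : X *m M = Y *m M.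
  by rewrite -x4 -{1}y1 -(mulmxA M) mulmxA trmx_mul x4 y4 -mulmxA (mulmxA M) x1.
by rewrite -x2 XMY -mulmxA MXY mulmxA.
Qed.

End Matrices.

Section LQ.
Variables (F : realType) (n m : nat).
Implicit Types (A Q P Pf M : 'M[F]_n) (B : 'M[F]_(n, m)).
Implicit Types (S : 'M[F]_(m, n)) (R : 'M[F]_m).

Definition costmx Q S R : 'M[F]_(n + m) := block_mx Q S^T S R.

Definition rotQ A Q M : 'M[F]_n := Q + A^T *m M *m A - M.
Definition rotS A B S M : 'M[F]_(m, n) := S + B^T *m M *m A.
Definition rotR B R M : 'M[F]_m := R + B^T *m M *m B.

Definition strictly_predissipative A B Q S R : Prop :=
  exists L : 'M[F]_n,
    [/\ L^T = L,
        psdmx (costmx (rotQ A Q L) (rotS A B S L) (rotR B R L)) &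
        pdmx (rotQ A Q L
              - (rotS A B S L)^T *m pinv (rotR B R L) *m rotS A B S L)].

Definition trajectory A B (N : nat) (x : nat -> 'cV[F]_n) (u : nat -> 'cV[F]_m)
    : Prop :=
  forall k, (k < N)%N -> x k.+1 = A *m x k + B *m u k.

Definition controllable A B : Prop :=
  forall a b : 'cV[F]_n, exists N x u,
    [/\ x 0%N = a, x N = b & trajectory A B N x u].

Definition gain A B S R P : 'M[F]_(m, n) :=
  pinv (R + B^T *m P *m B) *m (S + B^T *m P *m A).

Definition riccati A B Q S R P : 'M[F]_n :=
  Q + A^T *m P *m A - (S^T + A^T *m P *m B) *m gain A B S R P.

Definition riccati_iter A B Q S R Pf (N : nat) : 'M[F]_n :=
  iter N (riccati A B Q S R) Pf.

(* K_N and G_N are meant for N > 0 only; since 0.-1 = 0, their values at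
   N = 0 are those at N = 1. *)
Definition Kgain A B Q S R Pf (N : nat) : 'M[F]_(m, n) :=
  gain A B S R (riccati_iter A B Q S R Pf N.-1).

Definition Ggain A B Q S R Pf (N : nat) : 'M[F]_m :=
  let RP := rotR B R (riccati_iter A B Q S R Pf N.-1) in
  1%:M - pinv RP *m RP.

Definition cgdare A B Q S R P : Prop :=
  [/\ P^T = P, P = riccati A B Q S R P &
      ker_sub (R + B^T *m P *m B) (S^T + A^T *m P *m B)].

Definition stabilizing_cgdare A B Q S R P : Prop :=
  cgdare A B Q S R P /\ schur_stable (A - B *m gain A B S R P).

Definition revA A : 'M[F]_n := invmx A.
Definition revB A B : 'M[F]_(n, m) := invmx A *m B.
Definition revQ A Q : 'M[F]_n := - ((revA A)^T *m Q *m revA A).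
Definition revS A B Q S : 'M[F]_(m, n) :=
  S *m revA A - (revB A B)^T *m Q *m revA A.
Definition revR A B Q S R : 'M[F]_m :=
  - R + S *m revB A B + (revB A B)^T *m S^T - (revB A B)^T *m Q *m revB A B.

Definition stabilizing_rcgdare A B Q S R P : Prop :=
  stabilizing_cgdare (revA A) (revB A B) (revQ A Q) (revS A B Q S)
    (revR A B Q S R) P.

Definition ocp_cost Q S R Pf (N : nat)
    (x : nat -> 'cV[F]_n) (u : nat -> 'cV[F]_m) : F :=
  \sum_(k < N) qform (costmx Q S R) (col_mx (x k) (u k)) + qform Pf (x N).

Definition ocp_feasible A B (N : nat) (x0 : 'cV[F]_n)
    (x : nat -> 'cV[F]_n) (u : nat -> 'cV[F]_m) : Prop :=
  x 0%N = x0 /\ trajectory A B N x u.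

Definition ocp_optimal A B Q S R Pf (N : nat) (x0 : 'cV[F]_n)
    (x : nat -> 'cV[F]_n) (u : nat -> 'cV[F]_m) : Prop :=
  ocp_feasible A B N x0 x u /\
  forall x' u', ocp_feasible A B N x0 x' u' ->
    ocp_cost Q S R Pf N x u <= ocp_cost Q S R Pf N x' u'.

(* The inputs that receding-horizon control may apply at the state x0. *)
Definition ocp_first_input A B Q S R Pf (N : nat) (x0 : 'cV[F]_n)
    (w : 'cV[F]_m) : Prop :=
  exists x u, ocp_optimal A B Q S R Pf N x0 x u /\ u 0%N = w.

(* Global exponential stability of the origin for x+ = M x + L v, uniformly
   over all sequences v. *)
Definition globally_exp_stable (M : 'M[F]_n) (L : 'M[F]_(n, m)) : Prop :=
  exists c rho : F, [/\ 0 < c, 0 < rho, rho < 1 &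
    forall (x : nat -> 'cV[F]_n) (v : nat -> 'cV[F]_m),
      (forall k, x k.+1 = M *m x k + L *m v k) ->
      forall k, enorm (x k) <= c * rho ^+ k * enorm (x 0%N)].

End LQ.

(* Main.v *)
(* The stabilizing solution Ps of the reverse equation is itself a storage
   matrix: ell(x,u) + Ps(Ax+Bu) - Ps(x) >= 0. Since storage matrices form a
   convex set, a small move from Ps towards the strict one gives L <= Pf with
   ell(x,u) + L(Ax+Bu) - L(x) >= e |x|^2. In terms of W_N := P_N - L this is a
   problem with positive definite stage cost and nonnegative terminal cost.
   Controllability gives W_N <= C |x|^2 uniformly in N, whence a turnpike
   estimate W_{N+1} - W_N = O(1/N) |x|^2; therefore W_{N-1} is a Lyapunov
   function of the receding-horizon loop for N large. The free input v is
   harmless: as W_{N-1} > 0 for N >= 2, it only acts through directions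
   annihilated by B. *)

Require Import Defs.
From mathcomp Require Import all_boot all_order all_algebra.
From mathcomp Require Import all_classical all_reals.
From mathcomp Require Import complex ring lra.

Set Implicit Arguments.
Unset Strict Implicit.
Unset Printing Implicit Defensive.

Import Defs Order.TTheory GRing.Theory Num.Theory.
Local Open Scope ring_scope.

(** * Quadratic forms *)

Section BilinearForms.
Variable F : realType.

Definition bform m n (M : 'M[F]_(m, n)) (x : 'cV[F]_m) (y : 'cV[F]_n) : F :=
  (x^T *m M *m y) 0 0.

Definition sqnorm n (x : 'cV[F]_n) : F := \sum_i x i 0 ^+ 2.

Lemma qformE n (M : 'M[F]_n) x : qform M x = bform M x x.
Proof. by []. Qed.

Section Bilinearity.
Variables m n : nat.
Implicit Types (M N : 'M[F]_(m, n)) (x : 'cV[F]_m) (y : 'cV[F]_n).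

Lemma bformDl M x x' y : bform M (x + x') y = bform M x y + bform M x' y.
Proof. by rewrite /bform linearD /= !mulmxDl mxE. Qed.

Lemma bformDr M x y y' : bform M x (y + y') = bform M x y + bform M x y'.
Proof. by rewrite /bform mulmxDr mxE. Qed.

Lemma bformNl M x y : bform M (- x) y = - bform M x y.
Proof. by rewrite /bform linearN /= !mulNmx mxE. Qed.

Lemma bformNr M x y : bform M x (- y) = - bform M x y.
Proof. by rewrite /bform mulmxN mxE. Qed.

Lemma bformZl M a x y : bform M (a *: x) y = a * bform M x y.
Proof. by rewrite /bform linearZ /= -!scalemxAl mxE. Qed.

Lemma bformZr M a x y : bform M x (a *: y) = a * bform M x y.
Proof. by rewrite /bform -scalemxAr mxE. Qed.

Lemma bform0l M y : bform M 0 y = 0.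
Proof. by rewrite /bform linear0 !mul0mx mxE. Qed.

Lemma bform0r M x : bform M x 0 = 0.
Proof. by rewrite /bform mulmx0 mxE. Qed.

Lemma bformD M N x y : bform (M + N) x y = bform M x y + bform N x y.
Proof. by rewrite /bform mulmxDr mulmxDl mxE. Qed.

Lemma bformN M x y : bform (- M) x y = - bform M x y.
Proof. by rewrite /bform mulmxN mulNmx mxE. Qed.

Lemma bformZ a M x y : bform (a *: M) x y = a * bform M x y.
Proof. by rewrite /bform -scalemxAr -scalemxAl mxE. Qed.

Lemma bformT M x y : bform M^T y x = bform M x y.
Proof.
rewrite /bform; have -> : x^T *m M *m y = (y^T *m M^T *m x)^T.
  by rewrite !trmx_mul !trmxK mulmxA.
by rewrite [RHS]mxE.
Qed.

Lemma bformMr p M (N : 'M[F]_(n, p)) x z : bform (M *m N) x z = bform M x (N *m z).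
Proof. by rewrite /bform !mulmxA. Qed.

Lemma bformMl p (N : 'M[F]_(m, p)) M z y :
  bform (N^T *m M) z y = bform M (N *m z) y.
Proof. by rewrite /bform trmx_mul !mulmxA. Qed.

End Bilinearity.

Definition bformE := (bformDl, bformDr, bformNl, bformNr, bformZl, bformZr,
  bformD, bformN, bformZ, bform0l, bform0r).

Lemma qform_costmx n m (Q : 'M[F]_n) (S : 'M[F]_(m, n)) (R : 'M[F]_m) x u :
  qform (costmx Q S R) (col_mx x u) =
  qform Q x + 2 * bform S u x + qform R u.
Proof.
rewrite /qform /costmx tr_col_mx mul_row_block mul_row_col !mulmxDl.
rewrite mxE [X in X + _]mxE [X in _ + X]mxE.
rewrite -!/(bform _ _ _) bformT; ring.
Qed.

Lemma quadratic_discriminant (a b c : F) :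
  (forall t, 0 <= a + 2 * t * b + t ^+ 2 * c) -> b ^+ 2 <= a * c.
Proof.
move=> h; have [c0|c0] := eqVneq c 0.
  have [b0|b0] := eqVneq b 0; first by rewrite b0 c0 mulr0 expr0n.
  have := h (- (a + 1) / (2 * b)); rewrite c0 mulr0 addr0.
  have -> : a + 2 * (- (a + 1) / (2 * b)) * b = - 1 by field.
  by rewrite lerNr oppr0 ler10.
have := h (- b / c).
have -> : a + 2 * (- b / c) * b + (- b / c) ^+ 2 * c = (a * c - b ^+ 2) / c.
  by field.
have cp : 0 < c.
  rewrite lt_neqAle eq_sym c0 /= leNgt; apply/negP => cn.
  (* If c < 0, this [t] is at least 1 and large enough for t * (t * c + 2 * b) + a to be
     negative. *)
  pose t := (`|a| + 2 * `|b| + 1) / `|c| + 1.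
  have ac : `|c| = - c by rewrite ltr0_norm.
  have tc : t * c = - (`|a| + 2 * `|b| + 1) + c.
    by rewrite /t ac; field.
  have t1 : 1 <= t.
    by rewrite /t lerDr divr_ge0 // !addr_ge0 // mulr_ge0.
  have := h t.
  have := ler_norm a; have := ler_norm b; have := normr_ge0 a; have := normr_ge0 b.
  have -> : t ^+ 2 * c = t * (t * c) by ring.
  by rewrite tc; nra.
by rewrite pmulr_lge0 ?invr_gt0 // subr_ge0.
Qed.

Lemma cauchy_schwarz n (M : 'M[F]_n) x y : psdmx M ->
  bform M x y ^+ 2 <= qform M x * qform M y.
Proof.
move=> [sM pM]; apply: quadratic_discriminant => t.
have := pM (x + t *: y); rewrite !qformE !bformE.
have -> : bform M y x = bform M x y by rewrite -bformT sM.
by congr (_ <= _); ring.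
Qed.

(** Cauchy-Schwarz for the pair [M *m x], [x] bounds |Mx|^4 by 0. *)
Lemma psd_form0 n (M : 'M[F]_n) x : psdmx M -> qform M x = 0 -> M *m x = 0.
Proof.
move=> pM x0; suff h : (M *m x)^T *m ((M *m x)^T)^T = 0.
  by apply: trmx_inj; rewrite (gram_eq0 h) linear0.
have := cauchy_schwarz (M *m x) x pM.
rewrite x0 mulr0 => h; apply/matrixP => i j; rewrite !ord1 [RHS]mxE trmxK.
have /eqP : bform M (M *m x) x ^+ 2 = 0.
  by apply/eqP; rewrite eq_le h sqr_ge0.
by rewrite sqrf_eq0 /bform -mulmxA => /eqP.
Qed.

Lemma sqnormE n (x : 'cV[F]_n) : sqnorm x = qform 1%:M x.
Proof. by rewrite /qform mulmx1 mxE; apply: eq_bigr => i _; rewrite mxE expr2. Qed.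

Lemma sqnorm_ge0 n (x : 'cV[F]_n) : 0 <= sqnorm x.
Proof. by apply: sumr_ge0 => i _; exact: sqr_ge0. Qed.

Lemma sqnorm_eq0 n (x : 'cV[F]_n) : sqnorm x = 0 -> x = 0.
Proof.
move=> /eqP; rewrite psumr_eq0 => [/allP h|i _]; last exact: sqr_ge0.
apply/matrixP => i j; rewrite ord1 mxE; apply/eqP.
by rewrite -sqrf_eq0; exact: (h i (mem_index_enum i)).
Qed.

(** Each pair of coordinates is handled by 2|ab| <= a^2 + b^2. The explicit constant allows uniform
    use over a sequence of matrices. *)
Lemma qform_le_entries n (M : 'M[F]_n) (c : F) : (forall i j, `|M i j| <= c) ->
  forall x, `|qform M x| <= c * n%:R * sqnorm x.
Proof.
move=> hM x; have c0 (i : 'I_n) : 0 <= c by exact: (le_trans (normr_ge0 _) (hM i i)).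
have -> : qform M x = \sum_i \sum_j x i 0 * M i j * x j 0.
  rewrite /qform -mulmxA mxE; apply: eq_bigr => i _.
  by rewrite !mxE mulr_sumr; apply: eq_bigr => j _; rewrite mulrA.
have e : c * n%:R * sqnorm x =
    \sum_(i < n) \sum_(j < n) c / 2 * (x i 0 ^+ 2 + x j 0 ^+ 2).
  transitivity (\sum_(i < n) c / 2 * (n%:R * x i 0 ^+ 2 + sqnorm x)).
    rewrite -mulr_sumr big_split /= -mulr_sumr sumr_const card_ord -/(sqnorm x).
    by rewrite -mulr_natl; field.
  apply: eq_bigr => i _; rewrite -mulr_sumr big_split /= sumr_const card_ord.
  by rewrite mulr_natl.
rewrite e; apply: le_trans (ler_norm_sum _ _ _) _; apply: ler_sum => i _.
apply: le_trans (ler_norm_sum _ _ _) _; apply: ler_sum => j _.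
rewrite !normrM -[x i 0 ^+ 2]real_normK ?num_real //.
rewrite -[x j 0 ^+ 2]real_normK ?num_real //.
apply: (@le_trans _ _ (c * (`|x i 0| * `|x j 0|))).
  rewrite mulrAC mulrC; apply: ler_wpM2r; last exact: hM.
  by rewrite mulr_ge0 // normr_ge0.
rewrite mulrAC -mulrA; apply: ler_wpM2l; first exact: c0.
move: `|x i 0| `|x j 0| => {c0} a b.
by have := sqr_ge0 (a - b); rewrite sqrrB; lra.
Qed.

Lemma qform_bounded n (M : 'M[F]_n) :
  exists2 C : F, 0 < C & forall x, `|qform M x| <= C * sqnorm x.
Proof.
pose c := 1 + \sum_i \sum_j `|M i j|.
have s0 i : 0 <= \sum_j `|M i j| by apply: sumr_ge0.
have c0 : 0 < c by rewrite /c ltr_wpDr // sumr_ge0.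
(* [n.+1] keeps the constant positive in dimension 0. *)
exists (c * n.+1%:R); first by rewrite mulr_gt0 // ltr0Sn.
move=> x; apply: (@le_trans _ _ (c * n%:R * sqnorm x)).
  apply: qform_le_entries => i j; rewrite /c (bigD1 i) //= (bigD1 j) //=.
  have := s0 i; rewrite (bigD1 j) //= => _.
  have : 0 <= \sum_(k < n | k != j) `|M i k| by apply: sumr_ge0.
  have : 0 <= \sum_(k < n | k != i) \sum_l `|M k l| by apply: sumr_ge0.
  by lra.
apply: ler_wpM2r; first exact: sqnorm_ge0.
by apply: ler_wpM2l; [exact: ltW | rewrite ler_nat].
Qed.

(* Cauchy-Schwarz for M applied to x and M^-1 x gives
   |x|^4 <= qform M x * qform M^-1 x. *)
Lemma pd_lower_bound n (M : 'M[F]_n) : pdmx M ->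
  exists2 c : F, 0 < c & forall x, c * sqnorm x <= qform M x.
Proof.
move=> [sM pM].
have psM : psdmx M.
  split=> // x; have [->|x0] := eqVneq x 0; last exact/ltW/pM.
  by rewrite qformE bform0l.
have uM : M \in unitmx.
  rewrite -row_free_unit -kermx_eq0; apply/eqP/row_matrixP => i.
  rewrite row0; apply/eqP; rewrite -trmx_eq0; apply: contraT => /pM.
  rewrite /qform trmxK -row_mul mulmx_ker row0 mul0mx mxE ltxx //.
have [C C0 hC] := qform_bounded (invmx M).
exists C^-1; first by rewrite invr_gt0.
move=> x; have [->|x0] := eqVneq x 0.
  by rewrite qformE bform0l sqnormE qformE bform0l mulr0.
have := cauchy_schwarz x (invmx M *m x) psM.
rewrite -bformMr mulmxV // -qformE -sqnormE.
have -> : qform M (invmx M *m x) = qform (invmx M) x.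
  rewrite qformE -bformMr mulmxV // -bformMl trmx_inv sM mulmx1.
  by rewrite /bform.
move=> cs; have s0 : 0 < sqnorm x.
  rewrite lt_neqAle sqnorm_ge0 andbT eq_sym; apply: contra x0 => /eqP s0.
  exact/eqP/sqnorm_eq0.
rewrite mulrC ler_pdivrMr // -(ler_pM2r s0).
have := le_trans (ler_norm _) (hC x); have := pM _ x0.
by rewrite expr2 in cs; nra.
Qed.

Lemma pinv_sym n (M : 'M[F]_n) : M^T = M -> (pinv M)^T = pinv M.
Proof.
move=> sM; have [p1 p2 p3 p4] := pinvP M.
apply: (penrose_uniq (M := M)) => //; split.
- by rewrite -[RHS]sM -[in RHS]p1 !trmx_mul sM mulmxA.
- by rewrite -[in RHS]p2 !trmx_mul sM mulmxA.
- by rewrite trmx_mul trmxK sM -p4 trmx_mul sM.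
- by rewrite trmx_mul trmxK sM -p3 trmx_mul sM.
Qed.

Lemma mulmx_pinv_proj m n (M : 'M[F]_(m, n)) : M *m (1%:M - pinv M *m M) = 0.
Proof.
by have [p1 _ _ _] := pinvP M; rewrite mulmxBr mulmx1 mulmxA p1 subrr.
Qed.

Lemma ker_sub_proj m n p (M : 'M[F]_(m, n)) (N : 'M[F]_(p, n)) :
  ker_sub M N -> N *m (1%:M - pinv M *m M) = 0.
Proof.
move=> kMN; apply/matrixP => i j.
have /kMN : M *m ((1%:M - pinv M *m M) *m delta_mx j (0 : 'I_1)) = 0.
  by rewrite mulmxA mulmx_pinv_proj mul0mx.
by rewrite mulmxA -colE => /matrixP/(_ i 0); rewrite mxE => ->; rewrite !mxE.
Qed.

(** * Completing the square with a singular input weight *)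

Section CompletingTheSquare.
Variables (n m : nat).
Implicit Types (Q : 'M[F]_n) (S : 'M[F]_(m, n)) (R : 'M[F]_m).

(** By symmetry of [R], the kernel condition puts the columns of [S] in the range of [R], where
    [R *m pinv R] is the identity. *)
Lemma pinv_absorb S R : R^T = R -> ker_sub R S^T -> R *m pinv R *m S = S.
Proof.
move=> sR /ker_sub_proj h.
apply: trmx_inj; rewrite !trmx_mul pinv_sym // sR.
by apply/esym/eqP; rewrite -subr_eq0 -[X in X - _]mulmx1 -mulmxBr h.
Qed.

Lemma complete_square Q S R x u : R^T = R -> ker_sub R S^T ->
  qform (costmx Q S R) (col_mx x u) =
  qform (Q - S^T *m pinv R *m S) x + qform R (u + pinv R *m S *m x).
Proof.
move=> sR kR; have aS := pinv_absorb sR kR; have sP := pinv_sym sR.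
rewrite qform_costmx !qformE !bformE.
set y := pinv R *m S *m x.
have e1 : bform R u y = bform S u x by rewrite -bformMr mulmxA aS.
have e2 : bform R y u = bform S u x by rewrite -e1 -bformT sR.
have e3 : bform R y y = bform (S^T *m pinv R *m S) x x.
  rewrite -bformMr -bformMl; congr (bform _ x x).
  by rewrite trmx_mul sP -!mulmxA (mulmxA R) aS.
by rewrite e1 e2 e3; ring.
Qed.

(** At x = 0 the lower bound is 0, which gives the sign of [R]. Along v in the kernel of [R] the
    cost is affine in the scaling of v, so its slope must vanish; at x = [S^T *m v] this slope is
    2|x|^2. *)
Lemma bounded_below_psd_ker Q S R (L : 'M[F]_n) : R^T = R ->
  (forall x u, qform L x <= qform (costmx Q S R) (col_mx x u)) ->
  psdmx R /\ ker_sub R S^T.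
Proof.
move=> sR h; split; first split=> //.
  move=> u; have := h 0 u; rewrite qform_costmx !qformE !bformE.
  by rewrite mulr0 !add0r.
move=> v Rv; apply: sqnorm_eq0; set x := S^T *m v.
have -> : sqnorm x = bform S v x.
  by rewrite sqnormE qformE {1}/x -bformMl trmxK mulmx1.
apply/eqP; rewrite -sqrf_eq0 eq_le sqr_ge0 andbT.
rewrite -(mulr0 (qform Q x - qform L x)); apply: quadratic_discriminant => t.
have := h x (t *: v); rewrite qform_costmx !(qformE R) !bformE.
have -> : bform R v v = 0 by rewrite /bform -mulmxA Rv mulmx0 mxE.
by rewrite -subr_ge0; congr (_ <= _); ring.
Qed.

End CompletingTheSquare.
End BilinearForms.

(** * Decay of the powers of a Schur stable matrix *)

Section SchurDecay.
Variable F : realType.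
Local Notation "x %:C" := (real_complex F x) (format "x %:C").

Definition geometric m n (Y : nat -> 'M[F[i]]_(m, n)) : Prop :=
  exists c r : F, [/\ 0 <= c, 0 <= r, r < 1 &
    forall k i j, `|Y k i j| <= (c * r ^+ k)%:C].

Lemma geometric_recurrence m n z (Y D : nat -> 'M[F[i]]_(m, n)) : `|z| < 1 ->
  geometric D -> (forall k, Y k.+1 = z *: Y k + D k) -> geometric Y.
Proof.
have normE (w : F[i]) : exists2 a : F, 0 <= a & `|w| = a%:C.
  by rewrite normc_def; eexists; last reflexivity; exact: sqrtr_ge0.
have [l l0 lE] := normE z; rewrite lE ltcR => l1 [c [r [c0 r0 r1 hD]]] YS.
(* The rate must lie strictly above [l]: in the resonant case r = l the solution may carry an extra
   factor k. *)
pose q := (1 + Num.max r l) / 2.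
have mx1 : Num.max r l < 1 by rewrite gt_max r1 l1.
have rm : r <= Num.max r l by rewrite le_max lexx.
have lm : l <= Num.max r l by rewrite le_max lexx orbT.
have rq : r <= q by rewrite /q; lra.
have lq : l < q by rewrite /q; lra.
have q1 : q < 1 by rewrite /q; lra.
have [b b0 hb] : exists2 b : F, 0 <= b & forall i j, `|Y 0%N i j| <= b%:C.
  have [b b0 bE] := normE (\sum_i \sum_j `|Y 0%N i j|).
  exists b => // i j; rewrite -bE [leRHS]ger0_norm; last by do 2 apply: sumr_ge0 => ? _.
  rewrite (bigD1 i) //= (bigD1 j) //= -addrA lerDl.
  by rewrite addr_ge0 // !sumr_ge0 // => ? _; rewrite sumr_ge0.
have q0 : 0 <= q by exact: le_trans r0 rq.
have lq0 : 0 < q - l by rewrite subr_gt0.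
(* With X = b + c / (q - l), the induction needs l * X + c <= q * X; the gap is (q - l) * b. *)
exists (b + c / (q - l)), q; split=> //.
  by rewrite addr_ge0 // divr_ge0 // ltW.
elim=> [|k IH] i j.
  rewrite expr0 mulr1; apply: le_trans (hb i j) _; rewrite lecR lerDl.
  by rewrite divr_ge0 // ltW.
rewrite YS !mxE; apply: le_trans (ler_normD _ _) _; rewrite normrM lE.
have h : l%:C * `|Y k i j| <= (l * ((b + c / (q - l)) * q ^+ k))%:C.
  by rewrite rmorphM /=; apply: ler_wpM2l => //; rewrite lecR.
apply: le_trans (lerD h (hD k i j)) _; rewrite -rmorphD lecR.
have h1 : r ^+ k <= q ^+ k by rewrite lerXn2r // nnegrE.
have h2 := ler_wpM2l c0 h1.
have h3 : 0 <= (q - l) * b * q ^+ k.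
  by rewrite !mulr_ge0 ?exprn_ge0 // ltW.
have -> : (b + c / (q - l)) * q ^+ k.+1 =
    l * ((b + c / (q - l)) * q ^+ k) + (q - l) * b * q ^+ k + c * q ^+ k.
  by rewrite exprS; field; rewrite gt_eqF.
lra.
Qed.

(* Cayley-Hamilton gives the hypothesis for the list of eigenvalues; peeling
   off one factor at a time replaces the Jordan form. *)
Lemma geometric_annihilated n m (M : 'M[F[i]]_n.+1) (zs : seq F[i])
    (Y : nat -> 'M[F[i]]_(n.+1, m)) :
  (forall z, z \in zs -> `|z| < 1) -> (forall k, Y k.+1 = M *m Y k) ->
  horner_mx M (\prod_(z <- zs) ('X - z%:P)) *m Y 0%N = 0 -> geometric Y.
Proof.
elim: zs Y => [|z zs IH] Y hz YS.
  rewrite big_nil rmorph1 mul1mx => Y0.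
  have Yk k : Y k = 0 by elim: k => // k IHk; rewrite YS IHk mulmx0.
  by exists 0, 0; split=> // k i j; rewrite Yk mxE normr0 mul0r.
rewrite big_cons mulrC rmorphM /= -mulmxA => Y0.
have zY k : horner_mx M ('X - z%:P) *m Y k = Y k.+1 - z *: Y k.
  by rewrite rmorphB /= horner_mx_X horner_mx_C mulmxBl mul_scalar_mx YS.
apply: (@geometric_recurrence _ _ z _ (fun k => horner_mx M ('X - z%:P) *m Y k)).
- by apply: hz; rewrite mem_head.
- apply: IH Y0; first by move=> w wz; apply: hz; rewrite in_cons wz orbT.
  by move=> k; rewrite !zY mulmxBr -scalemxAr -!YS.
- by move=> k; rewrite zY addrC subrK.
Qed.

(** Each of the k terms of (1 - r)(1 + r + ... + r^(k-1)) = 1 - r^k is at least (1 - r) r^k, so r^k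
    = O(1/k) and the Archimedean property supplies k. *)
Lemma geometric_small (c r e : F) : 0 <= c -> 0 <= r -> r < 1 -> 0 < e ->
  exists k, c * r ^+ k < e.
Proof.
move=> c0 r0 r1 e0.
have bernoulli k : k%:R * (1 - r) * r ^+ k <= 1 - r ^+ k.
  elim: k => [|k IH]; first by rewrite !mul0r expr0 subrr.
  have h : r ^+ k.+1 <= 1 by rewrite exprn_ile1 // ltW.
  have := ler_wpM2l r0 IH; have r1' : 0 <= 1 - r by rewrite subr_ge0 ltW.
  have := ler_wpM2r r1' h; rewrite exprS -natr1; lra.
have d0 : 0 < e * (1 - r) by rewrite mulr_gt0 // subr_gt0.
have := @archi_boundP F (c / (e * (1 - r))) (divr_ge0 c0 (ltW d0)).
set k := Num.bound _; rewrite ltr_pdivrMr // => hk; exists k.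
have rk : 0 <= r ^+ k by rewrite exprn_ge0.
have [->|rk0] := eqVneq (r ^+ k) 0; first by rewrite mulr0.
have rkp : 0 < r ^+ k by rewrite lt_neqAle eq_sym rk0.
have := bernoulli k; rewrite -(ler_pM2l e0); move: hk; rewrite -(ltr_pM2r rkp).
by have := mulr_gt0 e0 rkp; lra.
Qed.

(** The characteristic polynomial splits over [F[i]] with roots in the open unit disc and
    annihilates [M], so the iterates are O(r^k) entrywise and the form is O(r^(2k)). *)
Lemma schur_decay n (M P : 'M[F]_n) x (e : F) : schur_stable M -> 0 < e ->
  exists k, `|qform P (iter k (mulmx M) x)| < e.
Proof.
case: n M P x => [|n] M P x sM e0.
  by exists 0%N; rewrite /= [x]flatmx0 qformE bform0r normr0.
pose Mc := map_mx (real_complex F) M.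
pose Y k := map_mx (real_complex F) (iter k (mulmx M) x).
have YS k : Y k.+1 = Mc *m Y k by rewrite /Y /= map_mxM.
have [zs zsE] := closed_field_poly_normal (char_poly Mc).
rewrite (monicP (char_poly_monic _)) scale1r in zsE.
have hz z : z \in zs -> `|z| < 1.
  by move=> zzs; apply: sM; rewrite eigenvalue_root_char zsE root_prod_XsubC.
have [|c [r [c0 r0 r1 hY]]] := geometric_annihilated hz YS.
  by rewrite -zsE Cayley_Hamilton mul0mx.
have [C C0 hC] := qform_bounded P.
have D0 : 0 <= C * (n.+1%:R * c ^+ 2).
  by rewrite (mulr_ge0 (ltW C0)) // (mulr_ge0 (ler0n _ _)) // sqr_ge0.
have r2 : r ^+ 2 < 1 by rewrite exprn_ilt1.
have [k hk] := geometric_small D0 (sqr_ge0 r) r2 e0.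
exists k; apply: le_lt_trans (hC _) (le_lt_trans _ hk).
rewrite -mulrA; apply: ler_wpM2l; first exact: ltW.
rewrite -mulrA mulr_natl -[n.+1 in leRHS]card_ord -sumr_const.
apply: ler_sum => i _.
have := hY k i 0; rewrite mxE normc_def lecR /= expr0n addr0 sqrtr_sqr.
move: (iter k (mulmx M) x i 0) => a ha.
rewrite -exprM mulnC exprM -exprMn -[leLHS]real_normK ?num_real //.
by rewrite lerXn2r // nnegrE // mulr_ge0 // exprn_ge0.
Qed.

End SchurDecay.

(** * Riccati operators and storage functions *)

Section Riccati.
Variables (F : realType) (n m : nat).
Variables (A : 'M[F]_n) (B : 'M[F]_(n, m)).
Variables (Q : 'M[F]_n) (S : 'M[F]_(m, n)) (R : 'M[F]_m).
Implicit Types (P L : 'M[F]_n).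

Lemma joint_cost P x u : P^T = P ->
  qform (costmx (Q + A^T *m P *m A) (S + B^T *m P *m A) (R + B^T *m P *m B))
    (col_mx x u) =
  qform (costmx Q S R) (col_mx x u) + qform P (A *m x + B *m u).
Proof.
move=> sP; rewrite !qform_costmx !qformE !bformE -!mulmxA !bformMl !bformMr.
have -> : bform P (A *m x) (B *m u) = bform P (B *m u) (A *m x).
  by rewrite -bformT sP.
ring.
Qed.

Lemma rotated_cost L x u : L^T = L ->
  qform (costmx (rotQ A Q L) (rotS A B S L) (rotR B R L)) (col_mx x u) =
  qform (costmx Q S R) (col_mx x u) + qform L (A *m x + B *m u) - qform L x.
Proof.
move=> sL; rewrite -joint_cost // !qform_costmx /rotQ /rotS /rotR.
by rewrite !qformE [bform (_ - L) _ _]bformD bformN; ring.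
Qed.

Hypotheses (sQ : Q^T = Q) (sR : R^T = R).

Lemma sym_congr p (M : 'M[F]_(n, p)) P : P^T = P -> (M^T *m P *m M)^T = M^T *m P *m M.
Proof. by move=> sP; rewrite !trmx_mul trmxK sP mulmxA. Qed.

Lemma cross_trmx P : P^T = P ->
  (S + B^T *m P *m A)^T = S^T + A^T *m P *m B.
Proof. by move=> sP; rewrite linearD /= !trmx_mul trmxK sP mulmxA. Qed.

Lemma input_weight_sym P : P^T = P -> (R + B^T *m P *m B)^T = R + B^T *m P *m B.
Proof. by move=> sP; rewrite linearD /= sym_congr // sR. Qed.

Lemma riccatiE P : P^T = P ->
  riccati A B Q S R P =
  Q + A^T *m P *m A - (S + B^T *m P *m A)^T *m pinv (R + B^T *m P *m B)
    *m (S + B^T *m P *m A).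
Proof. by move=> sP; rewrite /riccati /gain cross_trmx // mulmxA. Qed.

Lemma riccati_sym P : P^T = P -> (riccati A B Q S R P)^T = riccati A B Q S R P.
Proof.
move=> sP; rewrite riccatiE // linearB linearD /= sQ sym_congr //.
by rewrite !trmx_mul trmxK pinv_sym ?input_weight_sym // mulmxA.
Qed.

(** An identity rather than a minimum, because it also serves the reverse equation, whose input
    weight is only later shown to be nonpositive. *)
Lemma bellman P x u : P^T = P ->
  ker_sub (R + B^T *m P *m B) (S^T + A^T *m P *m B) ->
  qform (costmx Q S R) (col_mx x u) + qform P (A *m x + B *m u) =
  qform (riccati A B Q S R P) x
    + qform (R + B^T *m P *m B) (u + gain A B S R P *m x).
Proof.
move=> sP kP; rewrite -joint_cost // complete_square ?input_weight_sym //.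
  by rewrite -riccatiE.
by rewrite cross_trmx.
Qed.

(* In the paper's notation, H_L >= diag(e I, 0). *)
Definition storage (e : F) L := L^T = L /\ forall x u,
  e * sqnorm x + qform L x <=
  qform (costmx Q S R) (col_mx x u) + qform L (A *m x + B *m u).

(** Completing the square in the rotated cost leaves the Schur complement, at least c |x|^2, plus a
    nonnegative square. *)
Lemma predissipative_storage : strictly_predissipative A B Q S R ->
  exists (e : F) L, 0 < e /\ storage e L.
Proof.
move=> [L [sL pH pS]]; have [c c0 hc] := pd_lower_bound pS.
exists c, L; split=> //; split=> // x u.
have sRL : (rotR B R L)^T = rotR B R L by exact: input_weight_sym.
have [pR kR] : psdmx (rotR B R L) /\ ker_sub (rotR B R L) (rotS A B S L)^T.
  apply: (@bounded_below_psd_ker _ _ _ (rotQ A Q L) _ _ 0) => // y w.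
  by case: pH => _ /(_ (col_mx y w)); rewrite {2}/qform mulmx0 mul0mx mxE.
have := rotated_cost x u sL; rewrite complete_square //.
by have [_ /(_ (u + pinv (rotR B R L) *m rotS A B S L *m x))] := pR;
  have := hc x; lra.
Qed.

End Riccati.

(** * Time reversal and the stabilizing reverse solution *)

Section ReverseSystem.
Variables (F : realType) (n m : nat).
Variables (A : 'M[F]_n) (B : 'M[F]_(n, m)).
Variables (Q : 'M[F]_n) (S : 'M[F]_(m, n)) (R : 'M[F]_m).
Hypotheses (uA : A \in unitmx) (sQ : Q^T = Q) (sR : R^T = R).

(** A reverse step from z with input w leads to the state from which the forward input -w returns to
    z; the reverse data encode the negated cost of that forward step. *)
Lemma reverse_cost z w :
  qform (costmx (revQ A Q) (revS A B Q S) (revR A B Q S R)) (col_mx z w) =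
  - qform (costmx Q S R) (col_mx (revA A *m z + revB A B *m w) (- w)).
Proof.
rewrite /revQ /revS /revR; move: (revA A) (revB A B) => Ab Bb.
rewrite !qform_costmx !qformE !bformE -!mulmxA !bformMl !bformMr bformT.
have -> : bform Q (Ab *m z) (Bb *m w) = bform Q (Bb *m w) (Ab *m z).
  by rewrite -bformT sQ.
ring.
Qed.

Lemma revR_sym : (revR A B Q S R)^T = revR A B Q S R.
Proof.
rewrite /revR linearB !linearD linearN /= !trmx_mul !trmxK sQ sR !mulmxA.
by congr (_ - _); rewrite addrAC.
Qed.

(* E := Ps - L does not decrease along the stable closed loop of the reverse
   system and tends to 0 there, so E <= 0. One arbitrary input w at the origin
   followed by that closed loop then shows that the input weight of the
   reverse equation, on which cgdare imposes no sign, is <= 0. *)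
Lemma stabilizing_storage e L Ps : 0 <= e -> storage A B Q S R e L ->
  stabilizing_rcgdare A B Q S R Ps -> storage A B Q S R 0 Ps.
Proof.
move=> e0 [sL hL] [[sP fixP kP] schurK].
have sRb := revR_sym.
set K := gain _ _ _ _ _ in schurK.
set RP := revR A B Q S R + (revB A B)^T *m Ps *m revB A B in kP.
pose E z := qform Ps z - qform L z.
have back z w : A *m (revA A *m z + revB A B *m w) + B *m (- w) = z.
  by rewrite mulmxDr /revA /revB !mulmxA mulmxV // mul1mx mulmxN mul1mx addrK.
have step z w : - qform (costmx Q S R) (col_mx (revA A *m z + revB A B *m w) (- w))
    + qform Ps (revA A *m z + revB A B *m w)
    = qform Ps z + qform RP (w + K *m z).
  by rewrite -reverse_cost bellman // -fixP.
have Estep z w : E z + qform RP (w + K *m z) <= E (revA A *m z + revB A B *m w).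
  have := hL (revA A *m z + revB A B *m w) (- w); rewrite back.
  have := mulr_ge0 e0 (sqnorm_ge0 (revA A *m z + revB A B *m w)).
  by have := step z w; rewrite /E; lra.
have Ecl z : E z <= E ((revA A - revB A B *m K) *m z).
  have := Estep z (- (K *m z)).
  by rewrite addNr [qform _ 0]qformE bform0r addr0 mulmxBl mulmxN mulmxA.
have Eit k z : E z <= E (iter k (mulmx (revA A - revB A B *m K)) z).
  by elim: k => //= k IH; exact: le_trans IH (Ecl _).
have E_le0 z : E z <= 0.
  rewrite leNgt; apply/negP => Ez.
  have [k] := schur_decay (Ps - L) z schurK Ez.
  have := Eit k z; have := ler_norm (qform (Ps - L)
    (iter k (mulmx (revA A - revB A B *m K)) z)).
  rewrite {1}qformE bformD bformN -!qformE -/(E _).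
  move=> h1 h2 h3; have := le_lt_trans (le_trans h2 h1) h3.
  by rewrite ltxx.
have RP_le0 w : qform RP w <= 0.
  have := Estep 0 w; rewrite !mulmx0 add0r addr0.
  have := E_le0 (revB A B *m w).
  have -> : E 0 = 0 by rewrite /E !qformE !bform0r subrr.
  by lra.
split=> // x u; rewrite mul0r add0r.
(* At this pair the reverse step leads back to x, so the stage cost plus the change of [Ps] from x
   to Ax + Bu is minus a value of [RP]. *)
have := step (A *m x + B *m u) (- u).
have -> : revA A *m (A *m x + B *m u) + revB A B *m (- u) = x.
  by rewrite /revA /revB mulmxDr !mulmxA mulVmx // mul1mx mulmxN addrK.
rewrite opprK; have := RP_le0 (- u + K *m (A *m x + B *m u)); lra.
Qed.

End ReverseSystem.

(** * Receding-horizon control *)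

Section Lyapunov.
Variables (F : realType) (n m : nat).

(** [w] is comparable with the squared norm, hence the square roots in the constants. The input
    matrix is 0 because [B] will be shown to annihilate the free input directions. *)
Lemma lyapunov_exp_stable (M : 'M[F]_n) (w : 'cV[F]_n -> F) (a C q : F) :
  0 < a -> 0 < C -> 0 < q -> q < 1 ->
  (forall x, a * sqnorm x <= w x) -> (forall x, w x <= C * sqnorm x) ->
  (forall x, w (M *m x) <= q * w x) -> globally_exp_stable M (0 : 'M[F]_(n, m)).
Proof.
move=> a0 C0 q0 q1 wa wC wM.
exists (Num.sqrt (C / a)), (Num.sqrt q); split.
- by rewrite sqrtr_gt0 divr_gt0.
- by rewrite sqrtr_gt0.
- by rewrite -sqrtr1 ltr_sqrt.
move=> x v xS k.
have wk : w (x k) <= q ^+ k * w (x 0%N).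
  elim: k => [|k IH]; first by rewrite mul1r.
  rewrite xS mul0mx addr0 exprS -mulrA; apply: le_trans (wM _) _.
  by rewrite ler_pM2l.
rewrite -(@ler_pXn2r _ 2) ?nnegrE ?mulr_ge0 ?exprn_ge0 ?sqrtr_ge0 //.
rewrite !exprMn -exprM mulnC exprM !sqr_sqrtr ?sqnorm_ge0 ?(ltW q0) //;
  last by rewrite ltW // divr_gt0.
rewrite -!/(sqnorm _) -(ler_pM2l a0).
have -> : a * (C / a * q ^+ k * sqnorm (x 0%N)) = q ^+ k * (C * sqnorm (x 0%N)).
  by field; rewrite gt_eqF.
apply: le_trans (wa _) (le_trans wk _).
by apply: ler_wpM2l; rewrite ?exprn_ge0 // ltW.
Qed.

End Lyapunov.

Section RecedingHorizon.
Variables (F : realType) (n m : nat).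
Variables (A : 'M[F]_n) (B : 'M[F]_(n, m)).
Variables (Q : 'M[F]_n) (S : 'M[F]_(m, n)) (R : 'M[F]_m).
Implicit Types (P : 'M[F]_n).

(* L' := Ps + d (L - Ps) with d small is still below Pf and, the storage
   inequality being affine in the matrix, keeps the rate d e > 0. *)
Lemma storage_below_terminal e L Ps Pf : 0 < e -> storage A B Q S R e L ->
  storage A B Q S R 0 Ps -> pdmx (Pf - Ps) ->
  exists (e' : F) L', [/\ 0 < e', storage A B Q S R e' L' &
    forall x, qform L' x <= qform Pf x].
Proof.
move=> e0 [sL hL] [sP hP] /pd_lower_bound[c c0 hc].
have [C C0 hC] := qform_bounded (L - Ps).
(* d <= 1 keeps the combination convex; d * C <= c keeps it below [Pf]. *)
pose d := Num.min 1 (c / C); have d0 : 0 < d by rewrite lt_min ltr01 divr_gt0.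
have d1 : d <= 1 by rewrite ge_min lexx.
have dC : d * C <= c by rewrite -ler_pdivlMr // ge_min lexx orbT.
exists (d * e), (Ps + d *: (L - Ps)).
have qE x : qform (Ps + d *: (L - Ps)) x = (1 - d) * qform Ps x + d * qform L x.
  by rewrite !qformE !bformE; ring.
split; first by rewrite mulr_gt0.
  split; first by rewrite linearD linearZ linearB /= sL sP.
  move=> x u; rewrite !qE; have := hP x u; have := hL x u.
  move: (qform _ (col_mx x u)) => l hLx hPx.
  have h1 := ler_wpM2l (ltW d0) hLx.
  have d1' : 0 <= 1 - d by rewrite subr_ge0.
  by have := ler_wpM2l d1' hPx; lra.
move=> x; have := hc x.
have := le_trans (ler_norm _) (hC x); have := sqnorm_ge0 x.
rewrite !qformE !bformE => s0 h1 h2.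
have h3 := ler_wpM2l (ltW d0) h1.
by have := ler_wpM2r s0 dC; lra.
Qed.

Hypotheses (sQ : Q^T = Q) (sR : R^T = R).

(** * Cost-to-go matrices above a strict storage matrix *)

Section Fixed.
Variables (e : F) (L Pf : 'M[F]_n).
Hypotheses (e0 : 0 < e) (stL : storage A B Q S R e L).
Hypotheses (sPf : Pf^T = Pf) (leLPf : forall x, qform L x <= qform Pf x).

Let V N := riccati_iter A B Q S R Pf N.
Let W N x := qform (V N) x - qform L x.
Let RV N := R + B^T *m V N *m B.
Let K N := gain A B S R (V N).
Let ell x u := qform (costmx Q S R) (col_mx x u).

(** The storage inequality bounds the one-step cost with terminal matrix [P] below by [L] at x,
    whatever the input; hence the Riccati step is a true minimization. *)
Let input_bounds P : P^T = P -> (forall x, qform L x <= qform P x) ->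
  psdmx (R + B^T *m P *m B) /\ ker_sub (R + B^T *m P *m B) (S^T + A^T *m P *m B).
Proof.
move=> sP hP; rewrite -cross_trmx //.
apply: (@bounded_below_psd_ker _ _ _ (Q + A^T *m P *m A) _ _ L).
  exact: input_weight_sym.
move=> x u; rewrite joint_cost //.
have := (stL.2 x u); have := hP (A *m x + B *m u); have := sqnorm_ge0 x.
move=> s0; have := mulr_ge0 (ltW e0) s0; lra.
Qed.

Let VS N : V N.+1 = riccati A B Q S R (V N).
Proof. by []. Qed.

(** The Riccati update is the one-step cost at the input -Kx, which the storage inequality keeps
    above [L]. This makes [input_bounds] available at every index. *)
Lemma value_sym_ge N : (V N)^T = V N /\ forall x, qform L x <= qform (V N) x.
Proof.
elim: N => [|N [sV hV]]; first by [].
rewrite VS; split; first exact: riccati_sym.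
move=> x; have [[_ pR] kR] := input_bounds sV hV.
have := bellman Q sR x (- (K N *m x)) sV kR.
rewrite addNr [qform _ 0]qformE bform0r addr0 => <-.
have := stL.2 x (- (K N *m x)); have := hV (A *m x + B *m - (K N *m x)).
have := mulr_ge0 (ltW e0) (sqnorm_ge0 x); lra.
Qed.

Let sV N : (V N)^T = V N. Proof. by case: (value_sym_ge N). Qed.
Let W_ge0 N x : 0 <= W N x.
Proof. by rewrite subr_ge0; case: (value_sym_ge N). Qed.
Let psdR N : psdmx (RV N).
Proof. by case: (value_sym_ge N) => h1 h2; case: (input_bounds h1 h2). Qed.

Let bellmanV N x u : ell x u + qform (V N) (A *m x + B *m u) =
  qform (V N.+1) x + qform (RV N) (u + K N *m x).
Proof.
by rewrite bellman // ; case: (value_sym_ge N) => h1 h2; case: (input_bounds h1 h2).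
Qed.

(** * Dynamic programming for the finite-horizon problem *)

Lemma ocp_costS N x u :
  ocp_cost Q S R Pf N.+1 x u =
  ell (x 0%N) (u 0%N) + ocp_cost Q S R Pf N (fun k => x k.+1) (fun k => u k.+1).
Proof. by rewrite /ocp_cost big_ord_recl addrA. Qed.

Lemma ocp_cost_lower_bound N x u : trajectory A B N x u ->
  qform (V N) (x 0%N) <= ocp_cost Q S R Pf N x u.
Proof.
elim: N x u => [|N IH] x u tr; first by rewrite /ocp_cost big_ord0 add0r.
rewrite ocp_costS; have /IH : trajectory A B N (fun k => x k.+1) (fun k => u k.+1).
  by move=> k kN; rewrite tr.
have := bellmanV N (x 0%N) (u 0%N); rewrite -tr //.
have [_ /(_ (u 0%N + K N *m x 0%N))] := psdR N; lra.
Qed.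

Lemma ocp_cost_attained N x0 : exists x u,
  ocp_feasible A B N x0 x u /\ ocp_cost Q S R Pf N x u = qform (V N) x0.
Proof.
elim: N x0 => [|N IH] x0.
  exists (fun=> x0), (fun=> 0); split=> //.
  by rewrite /ocp_cost big_ord0 add0r.
pose w := - (K N *m x0).
have [x [u [[x1 tr] c]]] := IH (A *m x0 + B *m w).
exists (fun k => if k is k'.+1 then x k' else x0).
exists (fun k => if k is k'.+1 then u k' else w).
split; first by split=> // -[|k] kN //=; rewrite tr.
rewrite ocp_costS /= c bellmanV /w addNr [qform _ 0]qformE bform0r addr0 //.
Qed.

(** Optimality forces the square in [bellmanV] to vanish, i.e. w + K x0 to lie in the kernel of
    [RV N], which is the range of the projector [Ggain]. *)
Lemma ocp_first_inputP N x0 w :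
  ocp_first_input A B Q S R Pf N.+1 x0 w <->
  exists v, w = - Kgain A B Q S R Pf N.+1 *m x0 + Ggain A B Q S R Pf N.+1 *m v.
Proof.
rewrite /Kgain /Ggain /= -/(V N) -/(K N) /rotR -/(RV N).
split.
  move=> [x [u [[[x0E tr] opt] <-]]].
  have [x' [u' [feas c]]] := ocp_cost_attained N.+1 x0.
  have := opt _ _ feas; rewrite c ocp_costS.
  have /ocp_cost_lower_bound : trajectory A B N (fun k => x k.+1) (fun k => u k.+1).
    by move=> k kN; rewrite tr.
  rewrite tr // => h1 h2; have := bellmanV N (x 0%N) (u 0%N).
  rewrite -x0E in h2 *.
  have [_ /(_ (u 0%N + K N *m x 0%N))] := psdR N => h3 h4.
  have /(psd_form0 (psdR N)) r0 : qform (RV N) (u 0%N + K N *m x 0%N) = 0 by lra.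
  (* The projector fixes the kernel of [RV N], so this vector is its own preimage. *)
  exists (u 0%N + K N *m x 0%N).
  rewrite mulmxBl mul1mx -[pinv (RV N) *m RV N *m _]mulmxA r0 mulmx0 subr0.
  by rewrite mulNmx addrC addrK.
move=> [v wE].
have [x [u [[x1 tr] c]]] := ocp_cost_attained N (A *m x0 + B *m w).
exists (fun k => if k is k'.+1 then x k' else x0).
exists (fun k => if k is k'.+1 then u k' else w).
split=> //; split.
  by split=> // -[|k] kN //=; rewrite tr.
move=> x' u' [x'0 /ocp_cost_lower_bound]; rewrite x'0; apply: le_trans.
rewrite ocp_costS /= c bellmanV.
have -> : w + K N *m x0 = (1%:M - pinv (RV N) *m RV N) *m v.
  by rewrite wE mulNmx addrAC addNr add0r.
rewrite /qform -[_ *m RV N *m _]mulmxA [RV N *m _]mulmxA mulmx_pinv_proj.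
by rewrite mul0mx mulmx0 [X in _ + X]mxE addr0.
Qed.

(** * Decrease, uniform bound and turnpike of the rotated values *)

Lemma value_decrease N x :
  W N (A *m x + B *m (- (K N *m x))) + e * sqnorm x <= W N.+1 x.
Proof.
have := bellmanV N x (- (K N *m x)).
rewrite addNr [qform _ 0]qformE bform0r addr0.
by have := stL.2 x (- (K N *m x)); rewrite /W /ell; lra.
Qed.

Lemma value_optimal N x u :
  W N.+1 x <= ell x u + qform L (A *m x + B *m u) - qform L x
              + W N (A *m x + B *m u).
Proof.
have := bellmanV N x u; have [_ /(_ (u + K N *m x))] := psdR N.
by rewrite /W; lra.
Qed.

(** Following the trajectory suffices for long horizons, since every [W k] vanishes at the
    origin. *)
Lemma controlled_value_bounded N x u : trajectory A B N x u -> x N = 0 ->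
  exists c, forall k, W k (x 0%N) <= c.
Proof.
elim: N x u => [|N IH] x u tr xN.
  exists 0 => k; rewrite xN /W !qformE !bform0r; lra.
have [|//|c hc] := IH (fun k => x k.+1) (fun k => u k.+1).
  by move=> k kN; rewrite tr.
(* The first entry is for horizon 0; recursively, the maxima cover all horizons shorter than the
   trajectory. *)
exists (Num.max (W 0 (x 0%N)) (ell (x 0%N) (u 0%N) + qform L (x 1%N)
  - qform L (x 0%N) + c)).
case=> [|k]; rewrite le_max ?lexx //; apply/orP; right.
apply: (le_trans (value_optimal k (x 0%N) (u 0%N))); rewrite -tr //.
by rewrite lerD2l.
Qed.

(** Controllability bounds the diagonal entries of [V N - L] uniformly in N; Cauchy-Schwarz for this
    semidefinite matrix then bounds all entries. *)
Lemma value_upper_bound : controllable A B ->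
  exists2 C : F, 0 < C & forall N x, W N x <= C * sqnorm x.
Proof.
move=> ctr.
have /choice[c hc] : forall i : 'I_n, exists c, forall N, W N (delta_mx i 0) <= c.
  move=> i; have [N [x [u [<- xN tr]]]] := ctr (delta_mx i 0) 0.
  exact: controlled_value_bounded tr xN.
pose s := 1 + \sum_i c i.
have c0 i : 0 <= c i by exact: (le_trans (W_ge0 0 _) (hc i 0%N)).
have s0 : 0 < s by rewrite ltr_wpDr ?sumr_ge0.
have cs i : c i <= s.
  rewrite /s (bigD1 i) //=.
  have : 0 <= \sum_(j < n | j != i) c j by apply: sumr_ge0.
  lra.
have WE N x : W N x = qform (V N - L) x by rewrite /W !qformE !bformE.
have psW N : psdmx (V N - L).
  split; first by rewrite linearB /= sV stL.1.
  by move=> x; rewrite -WE.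
exists (s * n.+1%:R); first by rewrite mulr_gt0 // ltr0Sn.
move=> N x; rewrite WE; apply: (le_trans (ler_norm _)).
apply: (@le_trans _ _ (s * n%:R * sqnorm x)).
  apply: qform_le_entries => i j.
  have E : (V N - L) i j = bform (V N - L) (delta_mx i 0) (delta_mx j 0).
    by rewrite /bform trmx_delta -rowE -colE !mxE.
  rewrite -(@ler_pXn2r _ 2) ?nnegrE ?(ltW s0) // real_normK ?num_real // E.
  apply: (le_trans (cauchy_schwarz _ _ (psW N))); rewrite -!WE expr2.
  by apply: ler_pM; rewrite ?W_ge0 //; apply: (le_trans (hc _ N)).
apply: ler_wpM2r; first exact: sqnorm_ge0.
by apply: ler_wpM2l; [exact: ltW | rewrite ler_nat].
Qed.

(* A quantitative turnpike property. The optimal input for horizon N+1, used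
   as first input for horizon N+2, bounds the increment at x by the increment
   of index N at the successor y of x; the induction then charges the
   increment at x, at most C |x|^2, to the stage cost, at least e |x|^2. *)
Lemma value_increment C : 0 <= C -> (forall N x, W N x <= C * sqnorm x) ->
  forall N x, N%:R * (W N.+1 x - W N x) <= C / e * W N x.
Proof.
move=> C0 hC; have Ce : 0 <= C / e by rewrite divr_ge0 // ltW.
elim=> [|N IH] x; first by rewrite mul0r mulr_ge0.
set y := A *m x + B *m (- (K N *m x)).
have d := value_decrease N x; rewrite -/y in d.
have h1 : W N.+2 x - W N.+1 x <= W N.+1 y - W N y.
  have := value_optimal N.+1 x (- (K N *m x)).
  have := bellmanV N x (- (K N *m x)); rewrite -/y.
  by rewrite addNr [qform _ 0]qformE bform0r addr0 /W; lra.
have h2 := ler_wpM2l (ler0n F N) h1.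
have h3 := ler_wpM2l Ce d; have h4 := IH y; have h5 := hC N.+2 x.
have h6 := W_ge0 N.+1 x.
have h7 : C / e * (e * sqnorm x) = C * sqnorm x by field; rewrite gt_eqF.
by rewrite -natr1; lra.
Qed.

(** At state 0 an input w in the kernel of the input weight has total cost 0, so the storage
    inequality gives [W N] <= 0 at Bw. After at least one Riccati step [W N] dominates e |x|^2,
    hence Bw = 0. *)
Lemma input_kernel N : (0 < N)%N -> B *m Ggain A B Q S R Pf N.+1 = 0.
Proof.
case: N => // N _; rewrite /Ggain /= -/(V N.+1) /rotR -/(RV N.+1).
have BG : ker_sub (RV N.+1) B.
  move=> w Rw; apply: sqnorm_eq0.
  have := bellmanV N.+1 0 w; have := stL.2 0 w.
  have -> : qform (RV N.+1) (w + K N.+1 *m 0) = 0.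
    by rewrite mulmx0 addr0 /qform -mulmxA Rw mulmx0 mxE.
  rewrite mulmx0 add0r !(qformE _ 0) !bform0r => h1 h2.
  have h3 := value_decrease N (B *m w); have := W_ge0 N
    (A *m (B *m w) + B *m (- (K N *m (B *m w)))).
  have z0 := sqnorm_ge0 (0 : 'cV[F]_n); have s0 := sqnorm_ge0 (B *m w).
  have := mulr_ge0 (ltW e0) z0; have := mulr_ge0 (ltW e0) s0.
  rewrite /W /ell in h1 h2 h3 * => p2 p3 p4.
  have /eqP : e * sqnorm (B *m w) = 0 by lra.
  by rewrite mulf_eq0 gt_eqF //= => /eqP.
exact: ker_sub_proj.
Qed.

(** The Lyapunov function is [W N.+1]: a step loses at least e |x|^2 from [W N.+2], and for large N
    the increment from [W N.+1] to [W N.+2] gives back at most half of it. *)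
Lemma receding_horizon_stable : controllable A B -> exists N0, forall N,
  (N0 <= N)%N ->
  globally_exp_stable (A - B *m Kgain A B Q S R Pf N.+2)
                      (B *m Ggain A B Q S R Pf N.+2).
Proof.
(* Adding [e] gives C > e, so that the rate [q] below is positive. *)
move=> /value_upper_bound[C0 C00 hC0]; pose C := C0 + e.
have C_gt0 : 0 < C by rewrite addr_gt0.
have hC N x : W N x <= C * sqnorm x.
  by have := hC0 N x; have := mulr_ge0 (ltW e0) (sqnorm_ge0 x); rewrite /C; lra.
have b0 : 0 <= 2 * C ^+ 2 / e ^+ 2.
  by rewrite divr_ge0 ?sqr_ge0 // mulr_ge0 ?sqr_ge0.
(* The turnpike bound on the increment is C^2 / (e (N + 1)) |x|^2; this threshold brings it to at
   most e/2 |x|^2. *)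
exists (Num.bound (2 * C ^+ 2 / e ^+ 2)) => N hN; rewrite input_kernel //.
have NE : 2 * C ^+ 2 / e ^+ 2 <= N.+1%:R.
  apply: le_trans (ltW (archi_boundP b0)) _.
  by rewrite ler_nat (leq_trans hN).
rewrite ler_pdivrMr ?exprn_gt0 // in NE.
(* A loss of e/2 |x|^2 is at least the fraction e / (2 C) of [W N.+1]. *)
pose q := 1 - e / (2 * C).
have qC : e / (2 * C) * C = e / 2 by field; rewrite gt_eqF.
have eC : e / (2 * C) < 1.
  by rewrite ltr_pdivrMr ?mulr_gt0 // /C mul1r; have := e0; have := C00; lra.
have eC0 : 0 < e / (2 * C) by rewrite divr_gt0 ?mulr_gt0.
apply: (@lyapunov_exp_stable _ _ _ _ (W N.+1) e C q) => //.
- by rewrite /q subr_gt0.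
- by rewrite /q ltrBlDr ltrDl.
- move=> x; have := value_decrease N x.
  by have := W_ge0 N (A *m x + B *m (- (K N *m x))); lra.
- move=> x; have d := value_decrease N.+1 x.
  have -> : (A - B *m Kgain A B Q S R Pf N.+2) *m x =
      A *m x + B *m (- (K N.+1 *m x)).
    by rewrite mulmxBl mulmxN -[B *m _ *m x]mulmxA.
  have inc := value_increment (ltW C_gt0) hC N.+1 x.
  have h1 := ler_wpM2l (divr_ge0 (ltW C_gt0) (ltW e0)) (hC N.+1 x).
  have small : W N.+2 x - W N.+1 x <= e / 2 * sqnorm x.
    have N0 : 0 < N.+1%:R :> F by rewrite ltr0Sn.
    rewrite -(ler_pM2l N0); apply: le_trans inc (le_trans h1 _).
    rewrite -(@ler_pM2l _ (2 * e)) ?mulr_gt0 //.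
    have := ler_wpM2r (sqnorm_ge0 x) NE.
    have -> : 2 * e * (C / e * (C * sqnorm x)) = 2 * C ^+ 2 * sqnorm x.
      by field; rewrite gt_eqF.
    by move=> h; apply: le_trans h _; rewrite le_eqVlt; apply/orP; left;
      apply/eqP; field.
  have h2 := ler_wpM2l (ltW eC0) (hC N.+1 x).
  by rewrite /q; rewrite mulrA qC in h2; lra.
Qed.

End Fixed.
End RecedingHorizon.

Theorem theorem5p2 (F : realType) (nx nu : nat)
    (A : 'M[F]_nx) (B : 'M[F]_(nx, nu))
    (Q : 'M[F]_nx) (S : 'M[F]_(nu, nx)) (R : 'M[F]_nu)
    (Ps Pf : 'M[F]_nx)
    (hA : A \in unitmx)
    (hAB : controllable A B)
    (hH : (costmx Q S R)^T = costmx Q S R)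
    (hdiss : strictly_predissipative A B Q S R)
    (hPs : stabilizing_rcgdare A B Q S R Ps)
    (hPf : Pf^T = Pf)
    (hPfPs : pdmx (Pf - Ps)) :
  exists N0 : nat, forall N : nat, (0 < N)%N -> (N0 <= N)%N ->
    (forall (x0 : 'cV[F]_nx) (w : 'cV[F]_nu),
       ocp_first_input A B Q S R Pf N x0 w <->
       exists v : 'cV[F]_nu,
         w = - Kgain A B Q S R Pf N *m x0 + Ggain A B Q S R Pf N *m v) /\
    globally_exp_stable (A - B *m Kgain A B Q S R Pf N)
                        (B *m Ggain A B Q S R Pf N).
Proof.
have [sQ _ _ sR] : [/\ Q^T = Q, S^T = S^T, S = S & R^T = R].
  by move: hH; rewrite /costmx tr_block_mx => /eq_block_mx[].
have [e [L [e0 stL]]] := predissipative_storage sR hdiss.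
have stPs := stabilizing_storage hA sQ sR (ltW e0) stL hPs.
have [e' [L' [e'0 stL' LPf]]] := storage_below_terminal e0 stL stPs hPfPs.
have [N0 stab] := receding_horizon_stable sQ sR e'0 stL' hPf LPf hAB.
(* [receding_horizon_stable] at index N concerns horizon N + 2, hence the shift. *)
exists N0.+2 => -[//|N] _ hN; split.
  by move=> x0 w; exact: (ocp_first_inputP sQ sR e'0 stL' hPf LPf).
by case: N hN => // N hN; apply: stab.
Qed.
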